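(* The problem \textsc{bMVA} can be solved in time $O^*(4^{\zeta_{\mathcal B}\log(n)})$, where $\zeta_{\mathcal B}=k-\mathcal{B}$ and $\mathcal{B}=\max_{i\in[m]}\sum_{j=1}^n c(v^i_j)$.
   Context: Multidimensional Binary Vector Assignment (\textsc{bMVA}). An instance $\mathcal{I}[m,n,p,k]$ consists of integers $m,n,p\ge 1$ and $k\ge 0$, and $m$ sets (multisets) $V^1,\dots,V^m$, where each $V^i=\{v^i_1,\dots,v^i_n\}$ consists of $n$ binary vectors $v^i_j\in\{0,1\}^p$. A stack is an $m$-tuple $s=(v^s_1,\dots,v^s_m)$ with $v^s_i\in V^i$ for all $i\in[m]$; its associated vector is $v_s=\bigwedge_{i\in[m]}v^s_i$ (component-wise AND). A solution is a set $S=\{s_1,\dots,s_n\}$ of $n$ pairwise disjoint stacks, i.e. each vector $v^i_j$ belongs to exactly one stack. The cost of a vector $v\in\{0,1\}^p$ is its number of zeros, $c(v)=p-\sum_{r=1}^p v[r]$, and $c(S)=\sum_{j=1}^n c(v_{s_j})$. The question is whether there is a solution $S$ with $c(S)\le k$. Every solution has cost at least $\mathcal B$, so instances with $k<\mathcal B$ are negative; one considers instances with $\zeta_{\mathcal B}\ge 0$. The logarithm is in base 2, and $O^*(\cdot)$ hides factors polynomial in the size of the instance. *)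

(* Defs.v *)
From Corelib Require Import BinNums.
From mathcomp Require Import all_boot all_order all_algebra.
From mathcomp Require Import reals exp.

Set Implicit Arguments.
Unset Strict Implicit.
Unset Printing Implicit Defensive.

Import Order.TTheory GRing.Theory Num.Theory.

(* Model of computation: a first-order functional language with general
   recursion over binary trees (pure Lisp).  A program is a finite list of
   function bodies, every function has exactly one argument, and execution
   starts with function 0.  Each evaluation rule costs one time unit; a value is
   passed around as a pointer, and only its top constructor can be inspected in
   one step.  Such programs and Turing machines simulate each other with
   polynomial overhead, so an O^* bound does not depend on this choice. *)

Inductive tree : Type := Leaf | Node of tree & tree.

Fixpoint tree_size (x : tree) : nat :=
  if x is Node l r then (tree_size l + tree_size r).+1 else 1.

(* Variables are de Bruijn indices into the environment.
   [tCase e a b] evaluates [a] if [e] is [Leaf]; if [e] is [Node l r] it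
   evaluates [b] with [l] bound to index 0 and [r] to index 1. *)
Inductive term : Type :=
| tVar of nat
| tLeaf
| tNode of term & term
| tLet of term & term
| tCase of term & term & term
| tCall of nat & term.

Definition program := seq term.

(* [eval P env e v t]: in environment [env], the term [e] evaluates to [v] in
   exactly [t] steps.  The relation is deterministic in [v] and [t]. *)
Inductive eval (P : program) : seq tree -> term -> tree -> nat -> Prop :=
| eval_var env i :
    eval P env (tVar i) (nth Leaf env i) 1
| eval_leaf env :
    eval P env tLeaf Leaf 1
| eval_node env e1 e2 v1 v2 t1 t2 :
    eval P env e1 v1 t1 -> eval P env e2 v2 t2 ->
    eval P env (tNode e1 e2) (Node v1 v2) (t1 + t2).+1
| eval_let env e1 e2 v1 v2 t1 t2 :
    eval P env e1 v1 t1 -> eval P (v1 :: env) e2 v2 t2 ->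
    eval P env (tLet e1 e2) v2 (t1 + t2).+1
| eval_case_leaf env e a b v t1 t2 :
    eval P env e Leaf t1 -> eval P env a v t2 ->
    eval P env (tCase e a b) v (t1 + t2).+1
| eval_case_node env e a b l r v t1 t2 :
    eval P env e (Node l r) t1 -> eval P (l :: r :: env) b v t2 ->
    eval P env (tCase e a b) v (t1 + t2).+1
| eval_call env f e v w t1 t2 :
    eval P env e v t1 -> eval P [:: v] (nth tLeaf P f) w t2 ->
    eval P env (tCall f e) w (t1 + t2).+1.

Definition runs_in (P : program) (x y : tree) (t : nat) : Prop :=
  eval P [:: x] (nth tLeaf P 0) y t.

Definition enc_bool (b : bool) : tree := if b then Node Leaf Leaf else Leaf.

Definition enc_seq (T : Type) (enc : T -> tree) (s : seq T) : tree :=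
  foldr (fun x acc => Node (enc x) acc) Leaf s.

Fixpoint pos_bits (q : positive) : seq bool :=
  match q with
  | xH => [:: true]
  | xO q' => false :: pos_bits q'
  | xI q' => true :: pos_bits q'
  end.

Definition nat_bits (k : nat) : seq bool :=
  if bin_of_nat k is Npos q then pos_bits q else [::].

(* Binary, least significant bit first. *)
Definition enc_nat (k : nat) : tree := enc_seq enc_bool (nat_bits k).

(* [V i j] is the vector v^i_j.  The index [j] distinguishes equal vectors of
   the multiset V^i, so a stack is given by the index it selects in each V^i. *)
Definition vectors (m n p : nat) := 'I_m -> 'I_n -> p.-tuple bool.

Definition stack (m n : nat) := {ffun 'I_m -> 'I_n}.

Definition cost (p : nat) (v : p.-tuple bool) : nat :=
  p - \sum_(r < p) tnth v r.

Definition stack_vec (m n p : nat) (V : vectors m n p) (s : stack m n) :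
    p.-tuple bool :=
  [tuple \big[andb/true]_(i < m) tnth (V i (s i)) r | r < p].

Definition disjoint_stacks (m n : nat) (s s' : stack m n) : bool :=
  [forall i, s i != s' i].

Definition is_solution (m n : nat) (S : {set stack m n}) : bool :=
  (#|S| == n) &&
  [forall s in S, forall s' in S, (s != s') ==> disjoint_stacks s s'].

Definition solution_cost (m n p : nat) (V : vectors m n p)
    (S : {set stack m n}) : nat :=
  \sum_(s in S) cost (stack_vec V s).

Definition bMVA (m n p : nat) (V : vectors m n p) (k : nat) : bool :=
  [exists S : {set stack m n}, is_solution S && (solution_cost V S <= k)].

Definition lower_bound (m n p : nat) (V : vectors m n p) : nat :=
  \max_(i < m) \sum_(j < n) cost (V i j).

Definition zeta (m n p : nat) (V : vectors m n p) (k : nat) : int :=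
  (k%:Z - (lower_bound V)%:Z)%R.

(* The dimensions m, n and p are the lengths of the nested lists. *)
Definition enc_instance (m n p : nat) (V : vectors m n p) (k : nat) : tree :=
  Node (enc_nat k)
    (enc_seq (enc_seq (enc_seq enc_bool))
       [seq [seq tval (V i j) | j <- enum 'I_n] | i <- enum 'I_m]).

Definition instance_size (m n p : nat) (V : vectors m n p) (k : nat) : nat :=
  tree_size (enc_instance V k).

Definition log2 (R : realType) (x : R) : R := (ln x / ln 2)%R.

(* Main.v *)
(* Let U be a set V^i of maximal cost B, and consider the problem of assigning
   to every vector of U one vector from each V^i, bijectively, so that the ANDs
   have total cost at most k.  Its answer is that of the instance, and the cost
   of U is a lower bound.  If for every i there is a bijection under which each
   u in U is dominated by its image in V^i, the total cost is that of U and the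
   answer is immediate.  Otherwise pick an i without such a bijection: a
   solution assigns to some u in U a vector w in V^i with u <= w false, so one
   may guess (u, w) among n^2 pairs and replace u by u AND w, which makes U
   costlier by at least 1.  Hence the depth is at most k - B + 1, and there are
   about n^(2 (k - B)) = 4^((k - B) log n) nodes up to a factor n^2.  The
   existence of a bijection is a bipartite matching problem, solved by
   augmenting paths. *)

Require Import Defs.
From mathcomp Require Import all_boot all_order all_algebra.
From mathcomp Require Import reals exp.
From mathcomp Require Import zify ring.

Set Implicit Arguments.
Unset Strict Implicit.
Unset Printing Implicit Defensive.

(** * The program *)

(* The program in named notation.  [tCall i] calls line [i]; tuples are
   right-nested nodes, lists are as in [enc_seq], [None] is [Leaf] and [Some x]
   is [Node x Leaf], except that [pick] returns [Some (e, R)] as [Node e R].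
   Costs are unary numbers, i.e. lists of leaves; [k] stays in binary.

    0 main (k, Ws)            = solve ((k, Ws), best (head Ws, tail Ws))
    1 dom (u, w)              = u <= w componentwise
    2 andv (u, w)             = componentwise AND
    3 zvec (v, acc)           = acc + number of zeros of v
    4 zset (U, acc)           = acc + number of zeros of U
    5 leqU (a, b)             = a <= b, both unary
    6 best (U, Ws)            = a costliest element of U :: Ws
    7 dec k                   = Some (k - 1), or None if k = 0
    8 leqb (c, k)             = c <= k, with c unary and k binary
    9 pick (u, A)             = Some ((x, w), A - (x, w)) for the first (x, w)
                                in A with dom (u, w), or None
   10 try (u, (A, D))         = case pick (u, A) of
        None                 => (false, (A, D))
        Some ((None, w), R)  => (true, ((Some u, w) :: R, D))
        Some ((Some u', w), R) => case try (u', (R, D)) of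
          (true, (A', D'))   => (true, ((Some u, w) :: A', D'))
          (false, (A', D'))  => try (u, (A', (Some u', w) :: D'))
   11 catrev (s, t)           = rev s ++ t
   12 match ([::], A)         = true
      match (u :: us, A)      = case try (u, (A, [::])) of
        (true, (A', D'))     => match (us, catrev (D', A'))
        (false, _)           => false
   13 init W                  = [seq (None, w) | w <- W]
   14 findbad (U, Ws)         = Some W for the first W in Ws such that
                                match (U, init W) fails, or None
   15 solve ((k, Ws), U)      = zeros U <= k and, if findbad (U, Ws) = Some W,
                                branch1 ((k, Ws), (W, ([::], U)))
   16 branch1 (c, (W, (pre, u :: us)))
        = branch2 (c, (W, (u, (pre, us)))) or branch1 (c, (W, (u :: pre, us)))
   17 branch2 (c, (w :: ws, (u, (pre, us))))
        = ~ dom (u, w) and solve (c, catrev (pre, andv (u, w) :: us)),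
          or branch2 (c, (ws, (u, (pre, us)))) *)

Definition tTrue := tNode tLeaf tLeaf.

Definition main_body : term :=
  tCase (tVar 0) tLeaf (tCase (tVar 1) tLeaf
    (tCall 15 (tNode (tVar 4) (tCall 6 (tNode (tVar 0) (tVar 1)))))).

Definition dom_body : term :=
  tCase (tVar 0) tLeaf (tCase (tVar 0)
    (tCase (tVar 1) tTrue tLeaf)
    (tCase (tVar 3) tLeaf
      (tCase (tVar 2)
        (tCall 1 (tNode (tVar 3) (tVar 1)))
        (tCase (tVar 2) tLeaf (tCall 1 (tNode (tVar 7) (tVar 5))))))).

Definition andv_body : term :=
  tCase (tVar 0) tLeaf (tCase (tVar 0) tLeaf (tCase (tVar 3) tLeaf
    (tCase (tVar 2)
      (tNode tLeaf (tCall 2 (tNode (tVar 3) (tVar 1))))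
      (tNode (tVar 2) (tCall 2 (tNode (tVar 5) (tVar 3))))))).

Definition zvec_body : term :=
  tCase (tVar 0) tLeaf (tCase (tVar 0) (tVar 1)
    (tCase (tVar 0)
      (tCall 3 (tNode (tVar 1) (tNode tLeaf (tVar 3))))
      (tCall 3 (tNode (tVar 3) (tVar 5))))).

Definition zset_body : term :=
  tCase (tVar 0) tLeaf (tCase (tVar 0) (tVar 1)
    (tCall 4 (tNode (tVar 1) (tCall 3 (tNode (tVar 0) (tVar 3)))))).

Definition leqU_body : term :=
  tCase (tVar 0) tLeaf (tCase (tVar 0) tTrue (tCase (tVar 3) tLeaf
    (tCall 5 (tNode (tVar 3) (tVar 1))))).

Definition best_body : term :=
  tCase (tVar 0) tLeaf (tCase (tVar 1) (tVar 0)
    (tCase (tCall 5 (tNode (tCall 4 (tNode (tVar 2) tLeaf))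
                           (tCall 4 (tNode (tVar 0) tLeaf))))
      (tCall 6 (tNode (tVar 2) (tVar 1)))
      (tCall 6 (tNode (tVar 2) (tVar 3))))).

Definition dec_body : term :=
  tCase (tVar 0) tLeaf (tCase (tVar 0)
    (tCase (tCall 7 (tVar 1)) tLeaf (tNode (tNode tTrue (tVar 0)) tLeaf))
    (tNode (tNode tLeaf (tVar 3)) tLeaf)).

Definition leqb_body : term :=
  tCase (tVar 0) tLeaf (tCase (tVar 0) tTrue
    (tCase (tCall 7 (tVar 3)) tLeaf (tCall 8 (tNode (tVar 3) (tVar 0))))).

Definition pick_body : term :=
  tCase (tVar 0) tLeaf (tCase (tVar 1) tLeaf (tCase (tVar 0) tLeaf
    (tCase (tCall 1 (tNode (tVar 4) (tVar 1)))
      (tCase (tCall 9 (tNode (tVar 4) (tVar 3))) tLeaf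
        (tNode (tVar 0) (tNode (tVar 4) (tVar 1))))
      (tNode (tVar 4) (tVar 5))))).

Definition try_body : term :=
  tCase (tVar 0) tLeaf (tCase (tVar 1) tLeaf
    (tCase (tCall 9 (tNode (tVar 2) (tVar 0)))
      (tNode tLeaf (tNode (tVar 0) (tVar 1)))
      (tCase (tVar 0) tLeaf (tCase (tVar 0)
        (tNode tTrue (tNode
          (tNode (tNode (tNode (tVar 6) tLeaf) (tVar 1)) (tVar 3)) (tVar 5)))
        (tCase (tCall 10 (tNode (tVar 0) (tNode (tVar 5) (tVar 7)))) tLeaf
          (tCase (tVar 1) tLeaf (tCase (tVar 2)
            (tCall 10 (tNode (tVar 12)
              (tNode (tVar 0) (tNode (tVar 8) (tVar 1)))))
            (tNode tTrue (tNode
              (tNode (tNode (tNode (tVar 14) tLeaf) (tVar 9)) (tVar 2))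
              (tVar 3)))))))))).

Definition catrev_body : term :=
  tCase (tVar 0) tLeaf (tCase (tVar 0) (tVar 1)
    (tCall 11 (tNode (tVar 1) (tNode (tVar 0) (tVar 3))))).

Definition match_body : term :=
  tCase (tVar 0) tLeaf (tCase (tVar 0) tTrue
    (tCase (tCall 10 (tNode (tVar 0) (tNode (tVar 3) tLeaf))) tLeaf
      (tCase (tVar 0) tLeaf (tCase (tVar 3) tLeaf
        (tCall 12 (tNode (tVar 7) (tCall 11 (tNode (tVar 1) (tVar 0))))))))).

Definition init_body : term :=
  tCase (tVar 0) tLeaf (tNode (tNode tLeaf (tVar 0)) (tCall 13 (tVar 1))).

Definition findbad_body : term :=
  tCase (tVar 0) tLeaf (tCase (tVar 1) tLeaf
    (tCase (tCall 12 (tNode (tVar 2) (tCall 13 (tVar 0))))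
      (tNode (tVar 0) tLeaf)
      (tCall 14 (tNode (tVar 4) (tVar 3))))).

Definition solve_body : term :=
  tCase (tVar 0) tLeaf (tCase (tVar 0) tLeaf
    (tCase (tCall 8 (tNode (tCall 4 (tNode (tVar 3) tLeaf)) (tVar 0))) tLeaf
      (tCase (tCall 14 (tNode (tVar 5) (tVar 3))) tTrue
        (tCall 16 (tNode (tVar 6)
          (tNode (tVar 0) (tNode tLeaf (tVar 7)))))))).

Definition branch1_body : term :=
  tCase (tVar 0) tLeaf (tCase (tVar 1) tLeaf (tCase (tVar 1) tLeaf
    (tCase (tVar 1) tLeaf
      (tCase (tCall 17 (tNode (tVar 6)
               (tNode (tVar 4) (tNode (tVar 0) (tNode (tVar 2) (tVar 1))))))
        (tCall 16 (tNode (tVar 6)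
          (tNode (tVar 4) (tNode (tNode (tVar 0) (tVar 2)) (tVar 1)))))
        tTrue)))).

Definition branch2_body : term :=
  tCase (tVar 0) tLeaf (tCase (tVar 1) tLeaf (tCase (tVar 1) tLeaf
    (tCase (tVar 1) tLeaf (tCase (tVar 4) tLeaf
      (tCase (tCall 1 (tNode (tVar 4) (tVar 0)))
        (tCase (tCall 15 (tNode (tVar 8) (tCall 11 (tNode (tVar 2)
                 (tNode (tCall 2 (tNode (tVar 4) (tVar 0))) (tVar 3))))))
          (tCall 17 (tNode (tVar 8)
            (tNode (tVar 1) (tNode (tVar 4) (tNode (tVar 2) (tVar 3))))))
          tTrue)
        (tCall 17 (tNode (tVar 10)
          (tNode (tVar 3) (tNode (tVar 6) (tNode (tVar 4) (tVar 5))))))))))).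

Definition prog : program :=
  [:: main_body; dom_body; andv_body; zvec_body; zset_body; leqU_body;
      best_body; dec_body; leqb_body; pick_body; try_body; catrev_body;
      match_body; init_body; findbad_body; solve_body; branch1_body;
      branch2_body].

(** * Time-bounded evaluation *)

(** The time is only an upper bound, so budgets can be rounded up when evaluations are composed. *)
Definition runs (env : seq tree) (e : term) (v : tree) (T : nat) : Prop :=
  exists2 t, t <= T & eval prog env e v t.

Lemma runs_le env e v T1 T : runs env e v T1 -> T1 <= T -> runs env e v T.
Proof. by case=> t le_t ev le_T; exists t => //; apply: leq_trans le_T. Qed.

Lemma runs_var env i : runs env (tVar i) (nth Leaf env i) 1.
Proof. by exists 1 => //; apply: eval_var. Qed.

Lemma runs_leaf env : runs env tLeaf Leaf 1.
Proof. by exists 1 => //; apply: eval_leaf. Qed.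

Lemma runs_node env e1 e2 v1 v2 T1 T2 :
  runs env e1 v1 T1 -> runs env e2 v2 T2 ->
  runs env (tNode e1 e2) (Node v1 v2) (T1 + T2).+1.
Proof.
case=> t1 le1 ev1 [t2 le2 ev2]; exists (t1 + t2).+1; first by lia.
exact: eval_node.
Qed.

Lemma runs_call env f e v w T1 T2 :
  runs env e v T1 -> runs [:: v] (nth tLeaf prog f) w T2 ->
  runs env (tCall f e) w (T1 + T2).+1.
Proof.
case=> t1 le1 ev1 [t2 le2 ev2]; exists (t1 + t2).+1; first by lia.
exact: eval_call ev1 ev2.
Qed.

(* The budget [T] is consumed from the front rather than split in advance, so
   that the two branches of a case may use it differently. *)
Lemma runs_case env e a b s v T1 T :
  runs env e s T1 -> T1 < T ->
  match s with
  | Leaf => runs env a v (T - T1.+1)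
  | Node l r => runs (l :: r :: env) b v (T - T1.+1)
  end ->
  runs env (tCase e a b) v T.
Proof.
case=> t1 le1 ev1 ltT; case: s ev1 => [|l r] ev1 [t2 le2 ev2];
  exists (t1 + t2).+1; try lia.
- exact: eval_case_leaf ev1 ev2.
- exact: eval_case_node ev1 ev2.
Qed.

Ltac run_expr tac := lazymatch goal with
  | |- runs ?env (tVar ?i) _ _ =>
      let v := eval cbn [nth] in (nth Leaf env i) in
      exact (runs_var env i : runs env (tVar i) v 1)
  | |- runs _ tLeaf _ _ => exact: runs_leaf
  | |- runs _ (tNode _ _) _ _ => eapply runs_node; run_expr tac
  | |- runs _ tTrue _ _ => unfold tTrue; run_expr tac
  | |- runs _ (tCall _ _) _ _ =>
      eapply runs_call; [run_expr tac | cbn [nth prog]; tac]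
  end.

Arguments enc_seq : simpl never.

Lemma enc_nil T (enc : T -> tree) : enc_seq enc [::] = Leaf.
Proof. by []. Qed.

Lemma enc_cons T (enc : T -> tree) x s :
  enc_seq enc (x :: s) = Node (enc x) (enc_seq enc s).
Proof. by []. Qed.

(* [lia] splits on every boolean hypothesis, which makes it diverge on those
   about [all] and [perm_eq]. *)
Ltac arith :=
  repeat match goal with
  | H : ?P |- _ =>
      lazymatch type of P with
      | Prop => lazymatch P with
                | is_true (leq _ _) => fail
                | @eq ?T _ _ => tryif unify T nat then fail else clear H
                | _ => clear H
                end
      end
  end; lia.

Ltac run_with tac :=
  rewrite ?enc_nil ?enc_cons; cbv beta iota;
  lazymatch goal with
  | |- runs _ (tCase _ _ _) _ _ =>
      eapply runs_case; [run_expr tac | try solve [arith] | ];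
      rewrite ?enc_nil ?enc_cons; cbv beta iota
  | |- runs _ _ _ _ => eapply runs_le; [run_expr tac | try solve [arith]]
  end.

Tactic Notation "run" := run_with ltac:(fail).
Tactic Notation "run" uconstr(H) := run_with ltac:(eapply H).
Tactic Notation "run" uconstr(H1) "," uconstr(H2) :=
  run_with ltac:(first [eapply H1 | eapply H2]).
Tactic Notation "run" uconstr(H1) "," uconstr(H2) "," uconstr(H3) :=
  run_with ltac:(first [eapply H1 | eapply H2 | eapply H3]).

(** * Vectors, zero counts and binary numerals *)

Notation vec := (enc_seq enc_bool).

Definition dom (u w : seq bool) : bool := all2 implb u w.

Definition andv (u w : seq bool) : seq bool := [seq x.1 && x.2 | x <- zip u w].

Lemma run_dom u w :
  runs [:: Node (vec u) (vec w)] dom_body (enc_bool (dom u w))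
    (30 * (size u).+1).
Proof.
elim: u w => [|a u IH] [|b w]; rewrite /dom_body /=; repeat run.
case: a => /=; repeat run; last by run IH.
by case: b => /=; [run IH | run].
Qed.

Lemma run_andv u w :
  runs [:: Node (vec u) (vec w)] andv_body (vec (andv u w)) (30 * (size u).+1).
Proof.
elim: u w => [|a u IH] [|b w]; rewrite /andv_body /=; repeat run.
case: a => /=; last by run IH.
by run IH.
Qed.

Definition unary (c : nat) : tree := enc_seq id (nseq c Leaf).

Definition zeros (U : seq (seq bool)) : nat := sumn [seq count negb v | v <- U].

Lemma run_zvec v a :
  runs [:: Node (vec v) (unary a)] zvec_body (unary (count negb v + a))
    (30 * (size v).+1).
Proof.
elim: v a => [|b v IH] a; rewrite /zvec_body /=; repeat run.
case: b => /=; first by run IH.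
rewrite -addnA addnCA.
by run (IH (1 + a)).
Qed.

Notation mat := (enc_seq vec).

Definition rect (n p : nat) (U : seq (seq bool)) : bool :=
  (size U == n) && all (fun v => size v == p) U.

Lemma run_zset p U a : all (fun v => size v == p) U ->
  runs [:: Node (mat U) (unary a)] zset_body (unary (zeros U + a))
    ((size U).+1 * (30 * p + 60)).
Proof.
elim: U a => [|v U IH] a; rewrite /zset_body /=; first by move=> _; repeat run.
case/andP=> /eqP sz_v sz_U; do 2 run.
rewrite /zeros /= -addnA addnCA.
run run_zvec, IH => //.
Qed.

Lemma run_zeros n p U : rect n p U ->
  runs [:: Node (mat U) Leaf] zset_body (unary (zeros U))
    (60 * (n.+1 * p.+1)).
Proof.
case/andP=> /eqP sz_U /(run_zset 0); rewrite addn0 sz_U => run_U.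
by apply: runs_le run_U _; lia.
Qed.

Lemma zeros_le n p U : rect n p U -> zeros U <= n * p.
Proof.
case/andP=> /eqP <-; elim: U => //= v U IH /andP[/eqP sz_v /IH].
rewrite mulSn -[zeros (v :: U)]/(count negb v + zeros U) -sz_v.
exact: leq_add (count_size _ _).
Qed.

Lemma run_leqU a b :
  runs [:: Node (unary a) (unary b)] leqU_body (enc_bool (a <= b)) (30 * a.+1).
Proof.
elim: a b => [|a IH] [|b]; rewrite /leqU_body /unary /=; repeat run.
by run IH.
Qed.

Notation sys := (enc_seq mat).

Lemma run_best n p U Ws : rect n p U -> all (rect n p) Ws ->
  exists U0, [/\ U0 \in U :: Ws, {in U :: Ws, forall W, zeros W <= zeros U0}
    & runs [:: Node (mat U) (sys Ws)] best_body (mat U0)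
        ((size Ws).+1 * (200 * (n.+1 * p.+1) + 100))].
Proof.
elim: Ws U => [|W Ws IH] U rU.
  move=> _; exists U; split; first exact: mem_head.
    by move=> W; rewrite inE => /eqP->.
  by rewrite /best_body; repeat run.
move=> /andP[rW rWs].
have [/eqP sU aU] := andP rU; have [/eqP sW aW] := andP rW.
case: (leqP (zeros U) (zeros W)) => [leUW | ltWU].
- have [U0 [inU0 maxU0 runU0]] := IH W rW rWs.
  exists U0; split; first by rewrite inE inU0 orbT.
    move=> V; rewrite inE => /orP[/eqP->|]; last exact: maxU0.
    by apply: leq_trans leUW (maxU0 _ (mem_head _ _)).
  rewrite /best_body /=; do 2 run.
  have zU := zeros_le rU.
  run run_leqU, (run_zeros rU), (run_zeros rW).
  rewrite leUW /=; run runU0.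
have [U0 [inU0 maxU0 runU0]] := IH U rU rWs.
have leU := maxU0 _ (mem_head _ _).
exists U0; split.
- by move: inU0; rewrite !inE => /orP[->|->]; rewrite ?orbT.
- move=> V; rewrite !inE => /or3P[/eqP-> // | /eqP-> | VWs].
    exact: leq_trans (ltnW ltWU) leU.
  by apply: maxU0; rewrite inE VWs orbT.
rewrite /best_body /=; do 2 run.
have zU := zeros_le rU.
run run_leqU, (run_zeros rU), (run_zeros rW).
by rewrite leqNgt ltWU /=; run runU0.
Qed.

(** Repeated decrements leave high-order zeros, so the value has to make sense for lists that are
    not of the form [nat_bits k]. *)
Fixpoint bits_val (s : seq bool) : nat :=
  if s is b :: s' then b + (bits_val s').*2 else 0.

Lemma nat_bits_val k : bits_val (nat_bits k) = k.
Proof.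
rewrite -[RHS]bin_of_natK /nat_bits; case: (bin_of_nat k) => //= q.
by elim: q => //= q ->; rewrite NatTrec.doubleE.
Qed.

Definition enc_opt (T : Type) (enc : T -> tree) (o : option T) : tree :=
  if o is Some x then Node (enc x) Leaf else Leaf.

Fixpoint dec (s : seq bool) : option (seq bool) :=
  match s with
  | [::] => None
  | true :: s' => Some (false :: s')
  | false :: s' => if dec s' is Some r then Some (true :: r) else None
  end.

Lemma decP s :
  match dec s with
  | Some r => bits_val s = (bits_val r).+1 /\ size r = size s
  | None => bits_val s = 0
  end.
Proof.
elim: s => [|[] s IH] //=.
case: (dec s) IH => [r [IH sz]|IH] /=; last by rewrite IH.
by rewrite IH sz; split=> //; lia.
Qed.

Lemma run_dec s :
  runs [:: vec s] dec_body (enc_opt vec (dec s)) (30 * (size s).+1).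
Proof.
elim: s => [|[] s IH]; rewrite /dec_body /=; repeat run; rewrite /=.
  by run.
by run IH; case: (dec s) => [r|] /=; run.
Qed.

Lemma run_leqb c s :
  runs [:: Node (unary c) (vec s)] leqb_body (enc_bool (c <= bits_val s))
    (c.+1 * (30 * (size s) + 100)).
Proof.
elim: c s => [|c IH] s; rewrite /leqb_body /unary /=; repeat run.
run run_dec.
case: (dec s) (decP s) => [r [-> szr] | ->] /=; last by run; lia.
by run IH.
Qed.

Lemma run_catrev (T : Type) (enc : T -> tree) s1 s2 :
  runs [:: Node (enc_seq enc s1) (enc_seq enc s2)] catrev_body
    (enc_seq enc (catrev s1 s2)) (30 * (size s1).+1).
Proof.
elim: s1 s2 => [|x s1 IH] s2; rewrite /catrev_body /=; repeat run.
by run (IH (x :: s2)).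
Qed.

(** * Bipartite matching by augmenting paths *)

(* A pair [(Some u, w)] matches [u] to [w]; in [(None, w)] the vector [w] is
   still free. *)
Notation edge := (option (seq bool) * seq bool)%type.

Definition enc_edge (e : edge) : tree := Node (enc_opt vec e.1) (vec e.2).

Notation edges := (enc_seq enc_edge).

Definition lefts (A : seq edge) : seq (seq bool) := pmap fst A.

Definition valid (e : edge) : bool := if e.1 is Some u then dom u e.2 else true.

Lemma run_pick p u (A : seq edge) : size u = p ->
  exists r : option (edge * seq edge),
    match r with
    | Some (e, R) => dom u e.2 /\ perm_eq A (e :: R)
    | None => all (fun w => ~~ dom u w) (unzip2 A)
    end /\
    runs [:: Node (vec u) (edges A)] pick_body
      (if r is Some (e, R) then Node (enc_edge e) (edges R) else Leaf)
      ((size A).+1 * (30 * p + 100)).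
Proof.
move=> szu; elim: A => [|[x w] A [r [IHr IH]]].
  by exists None; split=> //; rewrite /pick_body /=; repeat run.
case dom_uw: (dom u w).
  exists (Some ((x, w), A)); split; first by split.
  rewrite /pick_body /=; do 3 run; rewrite /=.
  run run_dom; rewrite dom_uw /=.
  by run.
case: r => [[e R]|] in IHr IH *.
- have [dom_e permR] := IHr.
  exists (Some (e, (x, w) :: R)); split.
    split=> //; apply: (@perm_trans _ [:: (x, w), e & R]).
      by rewrite perm_cons.
    exact/permPl/(perm_catCA [:: _] [:: _]).
  rewrite /pick_body /=; do 3 run; rewrite /=.
  run run_dom; rewrite dom_uw /=.
  run IH. by run.
exists None; split; first by rewrite /= dom_uw.
rewrite /pick_body /=; do 3 run; rewrite /=.
run run_dom; rewrite dom_uw /=.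
by run IH; run.
Qed.

(* [A] holds the edges the search may still use and [D] those it has given up.
   On failure, no vector among [u] and the left ends of the newly discarded
   edges [D'] is dominated by a right end remaining in [A']: by counting, this
   violates Hall's condition (see [not_perfect]).  Every edge removed
   from [A] accounts for at most two recursive calls, hence the linear number
   of calls. *)
Definition try_time n p := n.+1 * (30 * p + 100) + 200.

Lemma run_try n p (A D : seq edge) u :
  size A <= n -> size u = p -> all (fun v => size v == p) (lefts A) ->
  all valid (A ++ D) ->
  (exists A' D' : seq edge,
    [/\ perm_eq (lefts (A' ++ D')) (u :: lefts (A ++ D)),
     perm_eq (unzip2 (A' ++ D')) (unzip2 (A ++ D)), all valid (A' ++ D') &
     runs [:: Node (vec u) (Node (edges A) (edges D))] try_body
       (Node (enc_bool true) (Node (edges A') (edges D')))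
       (try_time n p * (2 * size A).+1)]) \/
  (exists A' D' : seq edge, [/\ perm_eq A (A' ++ D'), size (lefts D') = size D',
     {in u :: lefts D', forall x, all (fun w => ~~ dom x w) (unzip2 A')} &
     runs [:: Node (vec u) (Node (edges A) (edges D))] try_body
       (Node (enc_bool false) (Node (edges A') (edges (D' ++ D))))
       (try_time n p * (2 * size D').+1)]).
Proof.
have [K defK] : {K | K = try_time n p} by exists (try_time n p).
rewrite -defK.
have [k] := ubnP (size A).
elim: k A D u => // k IH A D u ltAk leAn szu szA validAD.
have [r [Hr run_r]] := run_pick A szu.
have : (size A).+1 * (30 * p + 100) + 200 <= K.
  by rewrite defK leq_add2r leq_mul2r ltnS leAn orbT.
move: (_.+1 * _) run_r => T run_r leTK.
case: r => [[[x w] R]|] in Hr run_r; last first.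
  right; exists A, [::]; rewrite cats0; split=> //.
    by move=> x; rewrite inE => /eqP->.
  rewrite /try_body; do 2 run.
  run run_r. run.
have {Hr} [/= dom_uw permA] := Hr.
have permL : perm_eq (lefts A) (lefts ((x, w) :: R)) by exact: perm_pmap.
have permR : perm_eq (unzip2 A) (w :: unzip2 R) by exact: (perm_map snd permA).
have /andP[valid_A valid_D] : all valid A && all valid D by rewrite -all_cat.
have /andP[valid_xw valid_R] : valid (x, w) && all valid R.
  by rewrite -[_ && _]/(all valid (_ :: _)) -(perm_all _ permA).
have sizeA : size A = (size R).+1 by rewrite (perm_size permA).
case: x => [u'|] in permA permL valid_xw run_r *; last first.
  left; exists ((Some u, w) :: R), D; split.
  - by rewrite /lefts !pmap_cat perm_cons perm_cat2r perm_sym.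
  - by rewrite /unzip2 /= !map_cat -cat_cons perm_cat2r perm_sym.
  - by rewrite /= all_cat valid_R valid_D !andbT; exact: dom_uw.
  rewrite /try_body; do 2 run.
  by run run_r; rewrite /=; run; rewrite /=; run; run.
have [szu' szR] : size u' = p /\ all (fun v => size v == p) (lefts R).
  by move: szA; rewrite (perm_all _ permL) /= => /andP[/eqP].
have ltRk : size R < k by rewrite -ltnS -sizeA.
have leRn : size R <= n by apply: leq_trans leAn; rewrite sizeA.
have validRD : all valid (R ++ D) by rewrite all_cat valid_R.
case: (IH R D u' ltRk leRn szu' szR validRD).
  (* The old partner [u'] found another vector, which frees [w] for [u]. *)
  move=> [A1 [D1 [perm1L perm1R valid1 run1]]].
  left; exists ((Some u, w) :: A1), D1; split.
  - apply/permP=> a; move: (permP perm1L a) (permP permL a).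
    by rewrite /lefts /= !pmap_cat !count_cat /=; arith.
  - apply/permP=> a; move: (permP perm1R a) (permP permR a).
    by rewrite /unzip2 /= !map_cat !count_cat /=; arith.
  - by rewrite /= valid1 andbT; exact: dom_uw.
  rewrite /try_body; do 2 run.
  run run_r; rewrite /=; run; rewrite /=; run.
  run run1. run. run. rewrite /=. run.
(* No alternative for [u']: the edge to [w] is given up along with [D1], and the search for [u]
   resumes in [A1]. *)
move=> [A1 [D1 [perm1 sizeD1 hall1 run1]]].
have permL1 : perm_eq (lefts R) (lefts A1 ++ lefts D1).
  by rewrite -[_ ++ _]pmap_cat; apply: perm_pmap.
have permR1 : perm_eq (unzip2 R) (unzip2 A1 ++ unzip2 D1).
  by rewrite -[_ ++ _]map_cat; apply: perm_map.
have sizeR : size R = size A1 + size D1 by rewrite (perm_size perm1) size_cat.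
have /andP[szA1 szD1] : all (fun v => size v == p) (lefts A1) &&
    all (fun v => size v == p) (lefts D1).
  by rewrite -all_cat -(perm_all _ permL1).
have [valid_A1 valid_D1] : all valid A1 /\ all valid D1.
  by apply/andP; rewrite -all_cat -(perm_all _ perm1).
have posA1 := leq0n (K * size A1); have posD1 := leq0n (K * size D1).
have ltA1k : size A1 < k by arith.
have leA1n : size A1 <= n by arith.
have valid1 : all valid (A1 ++ (Some u', w) :: D1 ++ D).
  rewrite all_cat /= all_cat valid_A1 valid_D1 valid_D !andbT.
  exact: valid_xw.
case: (IH A1 _ u ltA1k leA1n szu szA1 valid1).
  move=> [A2 [D2 [perm2L perm2R valid2 run2]]].
  left; exists A2, D2; split=> //.
  - apply/permP=> a; move: (permP perm2L a) (permP permL a) (permP permL1 a).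
    rewrite /lefts /= !pmap_cat /= !pmap_cat !count_cat /= !count_cat /=.
    by arith.
  - apply/permP=> a; move: (permP perm2R a) (permP permR a) (permP permR1 a).
    rewrite /unzip2 /= !map_cat /= !map_cat !count_cat /= !count_cat /=.
    by arith.
  rewrite sizeA sizeR /try_body; do 2 run.
  run run_r; rewrite /=; run; rewrite /=; run.
  by run run1; run; run; rewrite /=; run run2.
move=> [A2 [D2 [perm2 sizeD2 hall2 run2]]].
have posD2 := leq0n (K * size D2).
have permL2 : perm_eq (unzip2 A1) (unzip2 A2 ++ unzip2 D2).
  by rewrite -[_ ++ _]map_cat; apply: perm_map.
(* What [hall1] says of [u'] and [D1] against [A1] persists, because the right ends of [A2] are
   among those of [A1]. *)
right; exists A2, (D2 ++ (Some u', w) :: D1); split.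
- apply/permP=> a; move: (permP permA a) (permP perm1 a) (permP perm2 a).
  by rewrite /= !count_cat /= => -> -> ->; arith.
- by rewrite /lefts pmap_cat /= !size_cat /= sizeD2 sizeD1.
- move=> v; rewrite /lefts pmap_cat inE mem_cat orbA => /orP[|inD1].
    by rewrite -in_cons => /hall2.
  have := hall1 _ inD1; rewrite (perm_all _ permL2) all_cat.
  by case/andP.
rewrite size_cat /= /try_body; do 2 run.
run run_r; rewrite /=; run; rewrite /=; run.
run run1; run; run; rewrite /= -catA cat_cons; run run2.
Qed.

(** A dominating bijection between multisets: permutations of the list of pairs account for repeated
    vectors. *)
Definition perfect (U W : seq (seq bool)) : Prop :=
  exists L : seq (seq bool * seq bool),
    [/\ perm_eq (unzip1 L) U, perm_eq (unzip2 L) W &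
        all (fun e => dom e.1 e.2) L].

(** Hall's condition fails: a bijection sends each occurrence of a member of [X] to a vector with a
    neighbour in [X], and such vectors occur only in [W2], which is too short. *)
Lemma not_perfect (U W X Y W1 W2 : seq (seq bool)) :
  perm_eq U (X ++ Y) -> perm_eq W (W1 ++ W2) ->
  {in X, forall x, all (fun w => ~~ dom x w) W1} -> size W2 < size X ->
  ~ perfect U W.
Proof.
move=> permU permW noedge ltWX [L [permL1 permL2 domL]].
pose nbr w := has (dom^~ w) X.
suff: size X <= size W2 by rewrite leqNgt ltWX.
have cX : size X <= count (mem X) U.
  rewrite (permP permU) count_cat; apply: leq_trans (leq_addr _ _).
  by rewrite -[leqLHS](count_predT X); apply/eq_leq/eq_in_count => x /= ->.
have cW : count nbr W <= size W2.
  rewrite (permP permW) count_cat -[leqRHS]add0n leq_add ?count_size //.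
  rewrite leqn0 -leqn0 leqNgt -has_count; apply/hasPn => w wW1.
  by apply/hasPn => x xX; apply: (allP (noedge x xX)).
apply: leq_trans cX (leq_trans _ cW).
rewrite -(permP permL1) -(permP permL2) !count_map.
elim: L domL {permL1 permL2} => //= e L IH /andP[dom_e /IH le_L].
apply: leq_add => //; case: (boolP (e.1 \in X)) => // eX.
by have -> : nbr e.2 by apply/hasP; exists e.1.
Qed.

(** The sizes force as many left ends as edges, so no edge is free and validity makes each one a
    dominating pair. *)
Lemma perfect_of_valid (A : seq edge) U W :
  perm_eq U (lefts A) -> perm_eq (unzip2 A) W -> size U = size W ->
  all valid A -> perfect U W.
Proof.
move=> permU permW sizeUW validA.
have {sizeUW} : size (lefts A) = size A.
  by rewrite -(perm_size permU) sizeUW -(perm_size permW) size_map.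
move=> sizeA.
suff [L [L1 L2 domL]] : exists L, [/\ unzip1 L = lefts A, unzip2 L = unzip2 A
    & all (fun e => dom e.1 e.2) L].
  by exists L; rewrite L1 L2 perm_sym.
elim: A sizeA validA {permU permW} => [|[[u|] w] A IH] /=; first by exists [::].
  rewrite /lefts /= => -[/IH{}IH] /andP[dom_uw /IH[L [L1 L2 domL]]].
  exists ((u, w) :: L); rewrite /= L1 L2 domL; split=> //.
  by rewrite andbT; exact: dom_uw.
rewrite /lefts /= => sizeA; have := size_pmap fst A.
rewrite sizeA => eqA.
by have := count_size (fun e : edge => isSome e.1) A; rewrite -eqA ltnn.
Qed.

Definition match_time n p := try_time n p * (2 * n).+1 + 30 * n + 200.

(** Invariant: [U] consists of the left ends matched in [A] and the pending [us], while the right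
    ends of [A] always form [W]. *)
Lemma run_match n p (U W us : seq (seq bool)) (A : seq edge) :
  all (fun v => size v == p) U -> size U = n -> size W = n ->
  perm_eq U (lefts A ++ us) -> perm_eq (unzip2 A) W -> all valid A ->
  exists b : bool, (b <-> perfect U W) /\
    runs [:: Node (mat us) (edges A)] match_body (enc_bool b)
      ((size us).+1 * match_time n p).
Proof.
move=> szp szU szW.
have [M defM] : {M | M = match_time n p} by exists (match_time n p).
have [K leK leM] : exists2 K, try_time n p * (2 * n).+1 <= K &
    K + 30 * n + 200 <= M.
  by exists (try_time n p * (2 * n).+1); rewrite ?defM.
rewrite -defM; clear defM.
elim: us A => [|u us IH] A permU permW validA.
  exists true; split.
    split=> // _; apply: (perfect_of_valid _ permW) => //; last by rewrite szU.
    by rewrite cats0 in permU.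
  by rewrite /match_body /=; repeat run.
have sizeA : size A = n by rewrite -szW -(perm_size permW) size_map.
have /andP[szA /= /andP[/eqP szu szus]] : all (fun v => size v == p) (lefts A)
    && all (fun v => size v == p) (u :: us).
  by rewrite -all_cat -(perm_all _ permU).
have leA : size A <= n by rewrite sizeA.
have validA0 : all valid (A ++ [::]) by rewrite cats0.
case: (run_try leA szu szA validA0) => [[A1 [D1 [perm1L perm1R valid1 run1]]]|].
  rewrite cats0 in perm1L perm1R.
  have perm1 : perm_eq (catrev D1 A1) (A1 ++ D1).
    by rewrite catrevE perm_sym perm_catC perm_cat2r perm_sym perm_rev.
  case: (IH (catrev D1 A1)).
  - apply: perm_trans permU _; apply/permP=> a.
    move: (permP (perm_pmap fst perm1) a) (permP perm1L a).
    by rewrite !count_cat /lefts /=; arith.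
  - apply: perm_trans permW; apply: perm_trans perm1R.
    exact: perm_map.
  - by rewrite (perm_all _ perm1).
  move=> b [bP run_b]; exists b; split=> //.
  have leD1 : size D1 <= n.
    rewrite -sizeA -(size_map snd A) -(perm_size perm1R) size_map size_cat.
    exact: leq_addl.
  rewrite sizeA in run1.
  have posM := leq0n (size us * M).
  rewrite /match_body /=; do 2 run.
  run (runs_le run1 leK); run; rewrite /=; run; run run_catrev, run_b.
move=> [A1 [D1 [perm1 sizeD1 hall1 run1]]].
exists false; split; first split=> //.
  move=> perf; exfalso; move: perf.
  (* The violating set is [u] with the left ends given up; it has one element more than the right
     ends of [D1]. *)
  apply: (@not_perfect _ _ (u :: lefts D1) (lefts A1 ++ us)
            (unzip2 A1) (unzip2 D1)).
  - apply: perm_trans permU _; apply/permP=> a.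
    move: (permP (perm_pmap fst perm1) a).
    by rewrite pmap_cat !count_cat /lefts /= ?count_cat /=; arith.
  - apply: perm_trans (_ : perm_eq _ (unzip2 A)) _; first by rewrite perm_sym.
    by rewrite -map_cat; apply: perm_map.
  - exact: hall1.
  - by rewrite /= sizeD1 size_map.
have leD1 : try_time n p * (2 * size D1).+1 <= K.
  apply: leq_trans leK; rewrite leq_mul2l ltnS leq_mul2l /= -sizeA.
  by rewrite (perm_size perm1) size_cat leq_addl orbT.
have posM := leq0n (size us * M).
rewrite /match_body /=; do 2 run.
by run (runs_le run1 leD1); run; rewrite /=; run.
Qed.

Lemma run_init W :
  runs [:: mat W] init_body (edges [seq (None, w) | w <- W]) (30 * (size W).+1).
Proof.
elim: W => [|w W IH]; rewrite /init_body /=; repeat run.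
by run IH.
Qed.

Definition findbad_time n p := match_time n p * n.+1 + 30 * n + 200.

Lemma run_findbad n p (U : seq (seq bool)) (Ws : seq (seq (seq bool))) :
  rect n p U -> all (rect n p) Ws ->
  exists o : option (seq (seq bool)),
    match o with
    | Some W => W \in Ws /\ ~ perfect U W
    | None => {in Ws, forall W, perfect U W}
    end /\
    runs [:: Node (mat U) (sys Ws)] findbad_body (enc_opt mat o)
      ((size Ws).+1 * findbad_time n p).
Proof.
move=> /andP[/eqP szU szp].
have [M defM] : {M | M = findbad_time n p} by exists (findbad_time n p).
have leM : match_time n p * n.+1 + 30 * n + 200 <= M by rewrite defM.
rewrite -defM; clear defM.
elim: Ws => [|W Ws IH] => [_|/andP[/andP[/eqP szW _] /IH[o [oP run_o]]]].
  by exists None; split=> //; rewrite /findbad_body /=; repeat run.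
have posM := leq0n (size Ws * M).
have [|||b [bP run_b]] :=
  @run_match n p U W U [seq (None, w) | w <- W] szp szU szW.
- by elim: (W).
- by rewrite /unzip2 -map_comp map_id.
- by elim: (W).
rewrite szU mulnC in run_b.
case: b bP run_b => [] bP run_b.
  exists o; split.
    case: o oP {run_o} => [V [VWs VP]|VP]; first by rewrite inE VWs orbT.
    move=> V; rewrite inE => /orP[/eqP->|]; [exact/bP | exact: VP].
  rewrite /findbad_body /=; do 2 run.
  by run run_init, run_b; rewrite /=; run run_o.
exists (Some W); split; first by split; [exact: mem_head | move/bP].
rewrite /findbad_body /=; do 2 run.
by run run_init, run_b; rewrite /=; run.
Qed.

(** The recursive calls to [solve] stay abstract: they decide [F] within time [C]. This lets the
    loop be used inside the induction of [run_solve]. *)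
Lemma run_branch2 (F : seq (seq bool) -> Prop) ctx C
    (ws : seq (seq bool)) u pre us :
  (forall w, w \in ws -> ~~ dom u w ->
    exists b : bool, (b <-> F (catrev pre (andv u w :: us))) /\
      runs [:: Node ctx (mat (catrev pre (andv u w :: us)))] solve_body
        (enc_bool b) C) ->
  exists b : bool,
    (b <-> exists w, [/\ w \in ws, ~~ dom u w &
                         F (catrev pre (andv u w :: us))]) /\
    runs [:: Node ctx (Node (mat ws) (Node (vec u) (Node (mat pre) (mat us))))]
      branch2_body (enc_bool b)
      (size ws * (C + 60 * size u + 30 * size pre + 300) + 100).
Proof.
move Ec: (60 * _) => c1; move Ec2: (30 * _) => c2.
elim: ws => [|w ws IH] solve_ok.
  exists false; split; first by split=> // -[w []].
  by rewrite /branch2_body /=; repeat run.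
have [|b [bP run_b]] := IH.
  by move=> w' w'ws; apply: solve_ok; rewrite inE w'ws orbT.
have posC := leq0n (size ws * C).
have pos1 := leq0n (size ws * c1).
have pos2 := leq0n (size ws * c2).
case dom_uw: (dom u w).
  exists b; split.
    rewrite bP; split=> -[w' [w'ws ndom Fw']]; exists w'; split=> //.
      by rewrite inE w'ws orbT.
    by move: w'ws ndom; rewrite inE => /orP[/eqP->|//]; rewrite dom_uw.
  rewrite /branch2_body /=; do 5 run.
  by run run_dom; rewrite dom_uw /=; run run_b.
have [|b' [b'P run_b']] := solve_ok w (mem_head _ _); first by rewrite dom_uw.
exists (b' || b); split.
  split=> [/orP[/b'P Fw|/bP[w' [w'ws ndom Fw']]]|[w' []]].
  - by exists w; rewrite mem_head dom_uw.
  - by exists w'; rewrite inE w'ws orbT.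
  - rewrite inE => /orP[/eqP->|w'ws] ndom Fw'; first by apply/orP/or_introl/b'P.
    by apply/orP/or_intror/bP; exists w'.
rewrite /branch2_body /=; do 5 run.
run run_dom; rewrite dom_uw /=.
run run_andv, (run_catrev vec pre (andv u w :: us)), run_b'.
by case: b' {b'P run_b'} => /=; [run | run run_b].
Qed.

(** [pre] holds the scanned part of the set in reverse order, and [catrev] restores the order. *)
Lemma run_branch1 (F : seq (seq bool) -> Prop) ctx C p n
    (W : seq (seq bool)) pre post :
  all (fun v => size v == p) post -> size pre + size post <= n ->
  (forall pre' u post' w, post = pre' ++ u :: post' -> w \in W -> ~~ dom u w ->
    exists b : bool, (b <-> F (catrev pre (pre' ++ andv u w :: post'))) /\
      runs [:: Node ctx (mat (catrev pre (pre' ++ andv u w :: post')))]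
        solve_body (enc_bool b) C) ->
  exists b : bool,
    (b <-> exists pre' u post' w, [/\ post = pre' ++ u :: post', w \in W,
             ~~ dom u w & F (catrev pre (pre' ++ andv u w :: post'))]) /\
    runs [:: Node ctx (Node (mat W) (Node (mat pre) (mat post)))]
      branch1_body (enc_bool b)
      (size post * (size W * (C + 60 * p + 30 * n + 300) + 300) + 100).
Proof.
elim: post pre => [|u us IH] pre /= szp sz_n solve_ok.
  exists false; split; last by rewrite /branch1_body /=; repeat run.
  by split=> // -[[|v pre'] [u [post' [w []]]]].
case/andP: szp => /eqP szu szus.
have [||b1 [b1P run1]] := IH (u :: pre) szus.
- by rewrite /= addSnnS.
- move=> pre' v post' w us_split wW ndom.
  by apply: (solve_ok (u :: pre') v post' w) => //; rewrite us_split.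
have [|b2 [b2P run2]] := @run_branch2 F ctx C W u pre us.
  by move=> w; apply: (solve_ok [::]).
exists (b2 || b1); split.
  split=> [/orP[/b2P[w [wW ndom Fw]]|/b1P]|].
  - by exists [::], u, us, w.
  - move=> [pre' [v [post' [w [us_split wW ndom Fw]]]]].
    by exists (u :: pre'), v, post', w; rewrite us_split.
  move=> [[|v pre'] [v' [post' [w [/= [<- us_split] wW ndom Fw]]]]].
    by apply/orP/or_introl/b2P; exists w; rewrite us_split.
  by apply/orP/or_intror/b1P; exists pre', v', post', w.
have {}run2 :
    runs [:: Node ctx (Node (mat W) (Node (vec u) (Node (mat pre) (mat us))))]
    branch2_body (enc_bool b2) (size W * (C + 60 * p + 30 * n + 300) + 100).
  by apply: runs_le run2 _; rewrite szu leq_add2r leq_mul2l; arith.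
move: (size W * _) run1 run2 => T run1 run2.
have posT := leq0n (size us * T).
rewrite /branch1_body /=; do 4 run.
run run2; case: b2 {b2P run2} => /=; run run1.
Qed.

(** * The branching algorithm *)

(** Cost of one node without its recursive calls: counting zeros, comparing with [k], searching for
    a set without a bijection, running both branching loops, and overhead. *)
Definition step_time m n p l :=
  60 * (n.+1 * p.+1) + (n * p).+1 * (30 * l + 100) + m.+1 * findbad_time n p
  + n * (n * (60 * p + 30 * n + 300) + 300) + 500.

Lemma size_andv u w : size u = size w -> size (andv u w) = size u.
Proof. by move=> sz; rewrite size_map size1_zip // sz. Qed.

Lemma zeros_cat U1 U2 : zeros (U1 ++ U2) = zeros U1 + zeros U2.
Proof. by rewrite /zeros map_cat sumn_cat. Qed.

Lemma zeros_andv_le u w : size u = size w ->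
  count negb u <= count negb (andv u w).
Proof.
elim: u w => [|a u IH] [|b w] //= [/IH]; rewrite -[[seq _ | x <- _]]/(andv u w).
by case: a; case: b => /=; arith.
Qed.

Lemma zeros_andv u w : size u = size w -> ~~ dom u w ->
  count negb u < count negb (andv u w).
Proof.
elim: u w => [|a u IH] [|b w] //= [sz]; rewrite -[[seq _ | x <- _]]/(andv u w).
have := zeros_andv_le sz; move/(_ w sz): IH; rewrite /dom /=.
by case: a; case: b => //= IH ?; rewrite ?add1n ?add0n ?ltnS // => /IH.
Qed.

Lemma rect_replace n p pre u v post : size v = size u ->
  rect n p (pre ++ u :: post) -> rect n p (pre ++ v :: post).
Proof. by move=> sz; rewrite /rect !all_cat /= !size_cat /= sz. Qed.

(* The two factors of the bound besides [step_time] are the depth of the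
   recursion, at most the number of ones of [U], and its width: every branching
   has at most [n * n] children and adds a zero to [U], and a node with more
   than [k] zeros is a leaf. *)
Lemma run_solve (F : seq (seq bool) -> Prop) m n p s
    (Ws : seq (seq (seq bool))) :
  0 < n -> size Ws = m -> all (rect n p) Ws ->
  (forall U, rect n p U -> F U -> zeros U <= bits_val s) ->
  (forall U, rect n p U -> zeros U <= bits_val s ->
    {in Ws, forall W, perfect U W} -> F U) ->
  (forall U W, rect n p U -> W \in Ws -> ~ perfect U W -> F U ->
    exists pre u post w, [/\ U = pre ++ u :: post, w \in W, ~~ dom u w &
      F (pre ++ andv u w :: post)]) ->
  (forall pre u post W w, rect n p (pre ++ u :: post) -> W \in Ws -> w \in W ->
    F (pre ++ andv u w :: post) -> F (pre ++ u :: post)) ->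
  forall U, rect n p U ->
  exists b : bool, (b <-> F U) /\
    runs [:: Node (Node (vec s) (sys Ws)) (mat U)] solve_body (enc_bool b)
      (step_time m n p (size s) * (n * p - zeros U).+1
       * n ^ (2 * ((bits_val s).+1 - zeros U))).
Proof.
move=> n_gt0 sizeWs rWs F_le F_leaf F_split F_mono U.
have [k] := ubnP (n * p - zeros U); elim: k U => // k IH U lt_k rU.
have zU := zeros_le rU.
have [/eqP szU sU] := andP rU.
have [S defS] : {S | S = step_time m n p (size s)} by eexists.
rewrite -defS in IH *.
have run_le : runs [:: Node (unary (zeros U)) (vec s)] leqb_body
    (enc_bool (zeros U <= bits_val s)) ((n * p).+1 * (30 * size s + 100)).
  by apply: runs_le (run_leqb _ _) _; rewrite leq_mul2r ltnS zU orbT.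
move: (run_zeros rU) => run_z.
have [o [oP run_o]] := run_findbad rU rWs.
rewrite sizeWs in run_o.
move: defS; rewrite /step_time.
move: (60 * (_ * _)) run_z => T1 run_z.
move: (_.+1 * (30 * _ + _)) run_le => T2 run_le.
move: (_.+1 * findbad_time _ _) run_o => T3 run_o defS.
have leS : S <=
    S * (n * p - zeros U).+1 * n ^ (2 * ((bits_val s).+1 - zeros U)).
  by rewrite -mulnA leq_pmulr // muln_gt0 expn_gt0 n_gt0.
have [leUk|ltkU] := leqP (zeros U) (bits_val s); last first.
  exists false; split; first by split=> // /(F_le _ rU); rewrite leqNgt ltkU.
  apply: runs_le leS; rewrite defS /solve_body; do 2 run.
  by run run_z, run_le; rewrite [_ <= bits_val s]leqNgt ltkU /=; run.
case: o oP run_o => [W|] oP run_o; last first.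
  exists true; split; first by split=> // _; apply: F_leaf.
  apply: runs_le leS; rewrite defS /solve_body; do 2 run.
  run run_z, run_le; rewrite leUk /=.
  by run run_o; rewrite /=; run.
have [W_Ws not_perf] := oP.
have /andP[/eqP szW sW] := allP rWs W W_Ws.
(* A bound for every child: with at least one more zero, its depth factor is smaller by at least one
   and its exponent by two, unless already zero. *)
set C := S * (n * p - zeros U) * n ^ (2 * (bits_val s - zeros U)).
have [//|||b [bP run_b]] :=
  @run_branch1 F (Node (vec s) (sys Ws)) C p n W [::] U.
- by rewrite /= szU.
- move=> pre u post w defU wW ndom.
  have szu : size u = p.
    by apply/eqP/(allP sU); rewrite defU mem_cat mem_head orbT.
  have szuw : size u = size w by rewrite szu; apply/esym/eqP/(allP sW).
  have rU' : rect n p (pre ++ andv u w :: post).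
    by apply: rect_replace (size_andv szuw) _; rewrite -defU.
  have ltz : zeros U < zeros (pre ++ andv u w :: post).
    rewrite defU !zeros_cat ltn_add2l.
    by rewrite /zeros /= ltn_add2r; apply: zeros_andv.
  have zU' := zeros_le rU'.
  have [|b [bP run_b]] := IH _ _ rU'; first by arith.
  exists b; split=> //; apply: runs_le run_b _.
  rewrite leq_mul //; first by rewrite leq_mul2l; arith.
  by apply: leq_pexp2l => //; arith.
exists b; split.
  rewrite bP; split=> [[pre [u [post [w [defU wW _]]]]]|FU].
    rewrite defU; apply: (F_mono _ _ _ W) => //; first by rewrite -defU.
  have [pre [u [post [w [defU wW ndom Fw]]]]] :=
    F_split _ _ rU W_Ws not_perf FU.
  by exists pre, u, post, w.
rewrite szU szW in run_b.
(* The [n * n] children absorb the two factors [n] missing from [C], and the extra unit of depth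
   pays for the node itself. *)
have leC : n * n * C + S
    <= S * (n * p - zeros U).+1 * n ^ (2 * ((bits_val s).+1 - zeros U)).
  rewrite subSn // [2 * _.+1]mulnS expnD [n ^ 2]expnS expn1.
  set e := n ^ _; rewrite /C -/e.
  have -> : S * (n * p - zeros U).+1 * (n * n * e)
    = n * n * (S * (n * p - zeros U) * e) + S * (n * n * e).
    by move: (n * p - zeros U) e => x e; arith.
  by rewrite leq_add2l leq_pmulr // !muln_gt0 n_gt0 expn_gt0 n_gt0.
apply: runs_le leC; rewrite defS.
have posC := leq0n (n * n * C).
have posp := leq0n (n * n * p).
have posn := leq0n (n * n * n).
rewrite /solve_body; do 2 run.
run run_z, run_le; rewrite leUk /=.
run run_o; rewrite /=; run run_b.
Qed.

(** * From stacks to lists of vectors *)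

Definition rows m n p (V : vectors m n p) (i : 'I_m) : seq (seq bool) :=
  [seq tval (V i j) | j <- enum 'I_n].

Definition all_rows m n p (V : vectors m n p) : seq (seq (seq bool)) :=
  [seq rows V i | i <- enum 'I_m].

(* The vectors of [U] act as one more set, whose [j]-th vector is assigned to
   the [j]-th stack. *)
Definition feasible m n p (V : vectors m n p) k (U : seq (seq bool)) : Prop :=
  exists sigma : 'I_n -> stack m n,
    (forall i, injective (fun j => sigma j i)) /\
    \sum_(j < n) count negb (andv (nth [::] U j) (stack_vec V (sigma j))) <= k.

Lemma domP u w : size u = size w ->
  reflect (forall r, nth false u r -> nth false w r) (dom u w).
Proof.
elim: u w => [|a u IH] [|b w] //=.
  by move=> _; apply: (iffP idP) => // _ [].
case=> /IH{}IH; rewrite /dom /=.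
apply: (iffP andP) => [[/implyP ab /IH uw] [|r]|uw].
- exact: ab.
- exact: uw.
- by split; [apply/implyP/(uw 0) | apply/IH => r; exact: (uw r.+1)].
Qed.

Lemma andv_idl u w : dom u w -> andv u w = u.
Proof.
rewrite /dom; elim: u w => [|a u IH] [|b w] //= /andP[ab /IH uw].
by rewrite -[LHS]/(a && b :: andv u w) uw; case: a b ab => [] [].
Qed.

Lemma andvC u w : andv u w = andv w u.
Proof.
elim: u w => [|a u IH] [|b w] //=.
by rewrite -[LHS]/(a && b :: andv u w) IH andbC.
Qed.

Lemma andvA : associative andv.
Proof.
elim=> [|a u IH] [|b v] [|c w] //=.
by rewrite -[LHS]/(a && (b && c) :: andv u (andv v w)) IH andbA.
Qed.

Lemma zeros_rect n p U : rect n p U ->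
  zeros U = \sum_(j < n) count negb (nth [::] U j).
Proof.
case/andP=> /eqP <- _; rewrite /zeros sumnE big_map (big_nth [::]).
by rewrite big_mkord.
Qed.

Lemma costE p (v : p.-tuple bool) : cost v = count negb v.
Proof.
rewrite /cost; have -> : \sum_(r < p) tnth v r = count id v.
  rewrite -(big_tuple _ _ v xpredT (fun b : bool => (b : nat))).
  by rewrite -sum1_count [RHS]big_mkcond.
by rewrite -{1}(size_tuple v) -(count_predC id) addKn.
Qed.

Lemma rect_rows m n p (V : vectors m n p) i : rect n p (rows V i).
Proof.
rewrite /rect size_map size_enum_ord eqxx; apply/allP => _ /mapP[j _ ->].
by rewrite size_tuple.
Qed.

Lemma nth_rows m n p (V : vectors m n p) i (j : 'I_n) :
  nth [::] (rows V i) j = V i j.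
Proof. by rewrite (nth_map j) ?size_enum_ord // nth_ord_enum. Qed.

Lemma zeros_rows m n p (V : vectors m n p) i :
  zeros (rows V i) = \sum_(j < n) cost (V i j).
Proof.
rewrite (zeros_rect (rect_rows V i)); apply: eq_bigr => j _.
by rewrite nth_rows costE.
Qed.

Lemma dom_stack_vec m n p (V : vectors m n p) (s : stack m n) i :
  dom (stack_vec V s) (V i (s i)).
Proof.
apply/domP; first by rewrite !size_tuple.
move=> r; case: (ltnP r p) => [lt_rp|le_pr]; last first.
  by rewrite nth_default ?size_tuple.
rewrite -[r]/(val (Ordinal lt_rp)) -!tnth_nth tnth_mktuple big_andE.
by move=> /forallP/(_ i).
Qed.

Lemma dom_to_stack_vec m n p (V : vectors m n p) u (s : stack m n) :
  size u = p -> (forall i, dom u (V i (s i))) -> dom u (stack_vec V s).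
Proof.
move=> szu dom_u; apply/domP; first by rewrite size_tuple.
move=> r ur; have lt_rp : r < p.
  by rewrite -szu ltnNge; apply: contraL ur => le; rewrite nth_default.
rewrite -[r]/(val (Ordinal lt_rp)) -tnth_nth tnth_mktuple big_andE.
apply/forallP => i /=; rewrite (tnth_nth false) /=.
by have /domP := dom_u i; apply; rewrite ?size_tuple.
Qed.

Lemma size_nth_rect n p U (j : 'I_n) : rect n p U -> size (nth [::] U j) = p.
Proof.
by case/andP=> /eqP szU /allP sU; apply/eqP/sU/mem_nth; rewrite szU.
Qed.

Lemma feasible_le m n p (V : vectors m n p) k U :
  rect n p U -> feasible V k U -> zeros U <= k.
Proof.
move=> rU [sigma [_]]; apply: leq_trans.
rewrite (zeros_rect rU); apply: leq_sum => j _.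
by apply: zeros_andv_le; rewrite size_tuple (size_nth_rect _ rU).
Qed.

(** [Is] gives the position in [L] of each vector of [U], and [Js] the index in [V i] of each right
    end of [L]; [pi] is their composition. *)
Lemma perfect_inj m n p (V : vectors m n p) U i :
  rect n p U -> perfect U (rows V i) ->
  exists pi : 'I_n -> 'I_n, injective pi /\
    forall j : 'I_n, dom (nth [::] U j) (V i (pi j)).
Proof.
move=> /andP[/eqP szU _] [L [permU permW domL]].
pose x0 : seq bool := [::].
have sizeL : size L = n by rewrite -(size_map fst) (perm_size permU).
have /(perm_iotaP x0)[Is permI defU] : perm_eq U (unzip1 L) by rewrite perm_sym.
have /(perm_iotaP x0)[Js permJ defL] := permW.
rewrite size_map sizeL in permI.
rewrite size_map size_enum_ord in permJ.
have sizeI : size Is = n by rewrite (perm_size permI) size_iota.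
have sizeJ : size Js = n by rewrite (perm_size permJ) size_iota.
have ltI j : j < n -> nth 0 Is j < n.
  by move=> ltj; have : nth 0 Is j \in iota 0 n;
    [rewrite -(perm_mem permI) mem_nth ?sizeI | rewrite mem_iota].
have ltJ j : j < n -> nth 0 Js j < n.
  by move=> ltj; have : nth 0 Js j \in iota 0 n;
    [rewrite -(perm_mem permJ) mem_nth ?sizeJ | rewrite mem_iota].
exists (fun j : 'I_n => Ordinal (ltJ _ (ltI _ (ltn_ord j)))); split.
  have uI : uniq Is by rewrite (perm_uniq permI) iota_uniq.
  have uJ : uniq Js by rewrite (perm_uniq permJ) iota_uniq.
  move=> j j' [/eqP]; rewrite nth_uniq ?sizeJ ?ltI // nth_uniq ?sizeI //.
  by move/eqP/val_inj.
move=> j; rewrite defU (nth_map 0) ?sizeI // (nth_map (x0, x0)) ?sizeL ?ltI //.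
set e := nth _ L _.
have -> : V i (Ordinal (ltJ _ (ltI _ (ltn_ord j)))) = e.2 :> seq bool.
  rewrite -nth_rows /= -[e.2](nth_map (x0, x0) x0 snd) ?sizeL ?ltI //.
  by rewrite -[map snd L]/(unzip2 L) defL (nth_map 0) ?sizeJ ?ltI.
by apply: (allP domL); rewrite mem_nth ?sizeL ?ltI.
Qed.

(** The [j]-th stack collects the images of the [j]-th vector of [U]; that vector is dominated by
    all of them, so the AND adds no zero. *)
Lemma feasible_leaf m n p (V : vectors m n p) k U :
  rect n p U -> zeros U <= k ->
  {in all_rows V, forall W, perfect U W} -> feasible V k U.
Proof.
move=> rU leUk perfU.
have /fin_all_exists[pi piP] : forall i, exists pi : 'I_n -> 'I_n,
    injective pi /\ forall j : 'I_n, dom (nth [::] U j) (V i (pi j)).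
  move=> i; apply: perfect_inj => //; apply: perfU.
  by apply: map_f; rewrite mem_enum.
exists (fun j => [ffun i => pi i j]); split.
  by move=> i j j'; rewrite !ffunE; apply: (piP i).1.
rewrite (eq_bigr (fun j : 'I_n => count negb (nth [::] U j)));
  rewrite -?(zeros_rect rU) // => j _.
rewrite andv_idl // dom_to_stack_vec ?(size_nth_rect j rU) //.
by move=> i; rewrite ffunE; apply: (piP i).2.
Qed.

Lemma perfect_of_inj m n p (V : vectors m n p) U i (pi : 'I_n -> 'I_n) :
  rect n p U -> injective pi ->
  (forall j : 'I_n, dom (nth [::] U j) (V i (pi j))) -> perfect U (rows V i).
Proof.
move=> /andP[/eqP szU _] pi_inj dom_pi.
exists [seq (nth [::] U (val j), tval (V i (pi j))) | j <- enum 'I_n]; split.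
- rewrite /unzip1 -map_comp /=.
  rewrite (map_comp (nth [::] U) val) val_enum_ord -szU map_nth_iota0 //.
  by rewrite take_size.
- rewrite /unzip2 -map_comp.
  rewrite (@eq_map _ _ _ ((fun j => tval (V i j)) \o pi)) // map_comp.
  apply: perm_map.
  apply: uniq_perm; rewrite ?map_inj_uniq -?enumT ?enum_uniq //.
  move=> j; rewrite mem_enum; have [g piK gK] := injF_bij pi_inj.
  by rewrite -[j]gK map_f ?mem_enum.
- by rewrite all_map; apply/allP => j _ /=.
Qed.

(** Coordinate [i] of [sigma] is a bijection, so it violates domination at some [j0]. The vector it
    selects there dominates the vector of its stack, so adding it to the AND changes nothing. *)
Lemma feasible_split m n p (V : vectors m n p) k U W :
  rect n p U -> W \in all_rows V -> ~ perfect U W -> feasible V k U ->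
  exists pre u post w, [/\ U = pre ++ u :: post, w \in W, ~~ dom u w &
    feasible V k (pre ++ andv u w :: post)].
Proof.
move=> rU /mapP[i _ ->] not_perf [sigma [sigma_inj cost_le]].
have [/forallP dom_sigma|] :=
  boolP [forall j : 'I_n, dom (nth [::] U j) (V i (sigma j i))].
  by case: not_perf; apply: perfect_of_inj dom_sigma.
rewrite negb_forall => /existsP[j0 ndom].
have szU : size U = n by case/andP: rU => /eqP.
have ltj : j0 < size U by rewrite szU.
exists (take j0 U), (nth [::] U j0), (drop j0.+1 U), (tval (V i (sigma j0 i))).
split=> //.
- by rewrite -drop_nth // cat_take_drop.
- by apply/mapP; exists (sigma j0 i); rewrite ?mem_enum.
exists sigma; split=> //.
rewrite (eq_bigr (fun j : 'I_n =>
  count negb (andv (nth [::] U j) (stack_vec V (sigma j))))) // => j _.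
rewrite nth_cat size_takel; last exact: ltnW.
case: (ltngtP j j0) => [ltjj|gtjj|/val_inj->].
- by rewrite nth_take.
- rewrite -[in LHS](subnKC gtjj) addSn -addnS addKn /= nth_drop.
  by rewrite subnKC.
rewrite subnn /= -andvA [andv (V _ _) _]andvC.
by rewrite (andv_idl (dom_stack_vec _ _ _)).
Qed.

(** Soundness of a guess: the same [sigma] works, since undoing an AND cannot create zeros. *)
Lemma feasible_mono m n p (V : vectors m n p) k pre u post W w :
  rect n p (pre ++ u :: post) -> W \in all_rows V -> w \in W ->
  feasible V k (pre ++ andv u w :: post) -> feasible V k (pre ++ u :: post).
Proof.
move=> rU /mapP[i _ ->] /mapP[j1 _ ->] [sigma [sigma_inj cost_le]].
exists sigma; split=> //; apply: leq_trans cost_le; apply: leq_sum => j _.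
have := size_nth_rect j rU; rewrite !nth_cat.
case: ltnP => // _; case: (j - size pre) => //= szu.
have sz_us : size u = size (stack_vec V (sigma j)) by rewrite szu size_tuple.
rewrite -andvA [andv (V _ _) _]andvC andvA; apply: zeros_andv_le.
by rewrite size_andv // szu size_tuple.
Qed.

(* The stacks may be numbered by the index they select in [V i0], and the extra
   copy of that set does not change their vectors. *)
Lemma bMVA_feasible m n p (V : vectors m n p) k i0 :
  bMVA V k <-> feasible V k (rows V i0).
Proof.
split=> [/existsP[S /andP[/andP[/eqP cardS /forall_inP disjS] cost_le]]|].
  have coord_inj i : {in S &, injective (fun s : stack m n => s i)}.
    move=> s s' sS s'S eq_i; apply/eqP/negPn/negP => neq.
    have /forall_inP/(_ s' s'S)/implyP/(_ neq)/forallP/(_ i) := disjS s sS.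
    by rewrite eq_i eqxx.
  have imS : [set s i0 | s : stack m n in S] = [set: 'I_n].
    apply/eqP; rewrite eqEcard subsetT cardsT card_ord.
    by rewrite card_in_imset ?cardS ?leqnn.
  have /fin_all_exists[sigma sigmaP] :
      forall j, exists s : stack m n, s \in S /\ s i0 = j.
    move=> j; have : j \in [set s i0 | s : stack m n in S] by rewrite imS inE.
    by case/imsetP => s sS ->; exists s.
  have sigma_inj : injective sigma.
    by move=> j j' eq_s; rewrite -(sigmaP j).2 eq_s (sigmaP j').2.
  have defS : S = [set sigma j | j : 'I_n].
    apply/esym/eqP.
    rewrite eqEcard card_imset // card_ord cardS leqnn andbT.
    by apply/subsetP => _ /imsetP[j _ ->]; case: (sigmaP j).
  exists sigma; split=> [i j j' eq_i|].
    by apply/sigma_inj/(coord_inj i); rewrite ?(sigmaP _).1.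
  apply: leq_trans cost_le.
  rewrite /solution_cost defS big_imset /=; last first.
    by move=> j j' _ _; apply: sigma_inj.
  rewrite big_mkcond /=; apply: leq_sum => j _; rewrite nth_rows costE.
  have := dom_stack_vec V (sigma j) i0; rewrite (sigmaP j).2 => dom_s.
  by rewrite andvC andv_idl.
case=> sigma [sigma_inj cost_le].
have inj : injective sigma.
  by move=> j j' eq_s; apply: (sigma_inj i0); rewrite eq_s.
apply/existsP; exists [set sigma j | j : 'I_n]; apply/andP; split.
  rewrite /is_solution card_imset // card_ord eqxx.
  apply/forall_inP => _ /imsetP[j _ ->]; apply/forall_inP => _ /imsetP[j' _ ->].
  apply/implyP => neq; apply/forallP => i; apply: contraNneq neq => eq_i.
  by rewrite (sigma_inj i _ _ eq_i).
apply: leq_trans cost_le; rewrite /solution_cost big_imset /=; last first.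
  by move=> j j' _ _; apply: inj.
rewrite big_mkcond /=; apply: leq_sum => j _; rewrite nth_rows costE andvC.
by apply: zeros_andv_le; rewrite !size_tuple.
Qed.

(** * Total running time in terms of the instance size *)

Lemma run_main m n p (V : vectors m n p) k : 0 < m -> 0 < n ->
  runs [:: enc_instance V k] main_body (enc_bool (bMVA V k))
    (m.+1 * (200 * (n.+1 * p.+1) + 100) +
     step_time m n p (size (nat_bits k)) * (n * p - lower_bound V).+1
     * n ^ (2 * (k.+1 - lower_bound V)) + 100).
Proof.
move=> m_gt0 n_gt0.
rewrite /enc_instance -[map _ (enum 'I_m)]/(all_rows V).
have size_all : size (all_rows V) = m by rewrite size_map size_enum_ord.
have rect_all : all (rect n p) (all_rows V).
  by apply/allP => _ /mapP[i _ ->]; apply: rect_rows.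
case def_all: (all_rows V) => [|W Ws].
  by rewrite -size_all def_all in m_gt0.
have /andP[rW rWs] : rect n p W && all (rect n p) Ws.
  by move: rect_all; rewrite def_all.
have [U [inU maxU run_U]] := run_best rW rWs.
rewrite -def_all in inU maxU *.
have /mapP[i0 _ defU] := inU.
(* Any set could start the search; a costliest one makes the exponent depend on
   [k - lower_bound V]. *)
have zU : zeros U = lower_bound V.
  apply/eqP; rewrite eqn_leq; apply/andP; split.
    by rewrite defU zeros_rows /lower_bound (leq_bigmax i0).
  apply/bigmax_leqP => i _; rewrite -zeros_rows; apply: maxU.
  by apply: map_f; rewrite mem_enum.
have rU : rect n p U by rewrite defU rect_rows.
have [||||b [bP run_b]] :=
  @run_solve (feasible V k) m n p (nat_bits k) (all_rows V)
    n_gt0 size_all rect_all _ _ _ _ U rU.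
- by move=> U' rU'; rewrite nat_bits_val; apply: feasible_le.
- by move=> U' rU'; rewrite nat_bits_val; apply: feasible_leaf.
- by move=> U' W'; apply: feasible_split.
- by move=> pre u post W' w; apply: feasible_mono.
have -> : bMVA V k = b.
  rewrite defU in bP; apply/idP/idP => [/(bMVA_feasible V k i0)/bP //|].
  by move=> /bP/(bMVA_feasible V k i0).
rewrite zU nat_bits_val in run_b.
have {}run_U : runs [:: Node (mat W) (sys Ws)] best_body (mat U)
    (m.+1 * (200 * (n.+1 * p.+1) + 100)).
  by apply: runs_le run_U _; rewrite leq_mul2r -size_all def_all /= leqW ?orbT.
move: (_.+1 * (200 * _ + _)) (_ * n ^ _) run_U run_b => T1 T2 run_U run_b.
rewrite /main_body /enc_nat def_all in run_b *.
by do 2 run; run run_U, run_b.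
Qed.

(** The degree 9 is 5 for [step_time], 2 for the depth factor [x.+1], and 2 for the surplus [n ^ 2]
    in the exponent [2 * z.+1]. *)
Lemma main_time_le N m n p l z x :
  m <= N -> 0 < n <= N -> p <= N -> l <= N -> x <= n * p ->
  m.+1 * (200 * (n.+1 * p.+1) + 100) +
    step_time m n p l * x.+1 * n ^ (2 * z.+1) + 100
  <= 200 * 100 * N ^ 9 * n ^ (2 * z).
Proof.
move=> le_m /andP[n_gt0 le_n] le_p le_l le_x.
have N_gt0 : 0 < N by apply: leq_trans le_n.
have le_try : try_time n p <= 460 * N ^ 2.
  rewrite /try_time expnS expn1.
  apply: (@leq_trans ((N + N) * (30 * N + 100 * N) + 200 * (N * N))).
    by apply: leq_add; [apply: leq_mul; lia | nia].
  by lia.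
have le_match : match_time n p <= 1610 * N ^ 3.
  rewrite /match_time [N ^ 3]expnS.
  apply: (@leq_trans (460 * N ^ 2 * (3 * N) + 230 * (N * N ^ 2))); last by lia.
  rewrite -addnA; apply: leq_add; first by apply: leq_mul => //; lia.
  have : 0 < N ^ 2 by rewrite expn_gt0 N_gt0.
  by nia.
have le_find : findbad_time n p <= 3450 * N ^ 4.
  rewrite /findbad_time [N ^ 4]expnS.
  apply: (@leq_trans (1610 * N ^ 3 * (2 * N) + 230 * (N * N ^ 3))); last by lia.
  rewrite -addnA; apply: leq_add; first by apply: leq_mul => //; lia.
  have : 0 < N ^ 3 by rewrite expn_gt0 N_gt0.
  by nia.
have powN i j : i <= j -> N ^ i <= N ^ j by apply: leq_pexp2l.
have le_n1 : n.+1 <= 2 * N by lia.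
have le_p1 : p.+1 <= 2 * N by lia.
have le_m1 : m.+1 <= 2 * N by lia.
have le_np : (n * p).+1 <= 2 * N ^ 2.
  rewrite expnS expn1; have := leq_mul le_n le_p.
  by have := leq_mul N_gt0 N_gt0; lia.
have le_n1p1 : n.+1 * p.+1 <= 4 * N ^ 2.
  by apply: leq_trans (leq_mul le_n1 le_p1) _; rewrite expnS expn1; lia.
have le_step : step_time m n p l <= 86 * 100 * N ^ 5.
  rewrite /step_time.
  have le2 : (n * p).+1 * (30 * l + 100) <= 260 * N ^ 3.
    apply: (@leq_trans (2 * N ^ 2 * (130 * N))).
      by apply: leq_mul => //; lia.
    by rewrite [N ^ 3]expnS; lia.
  have le3 : m.+1 * findbad_time n p <= 69 * 100 * N ^ 5.
    apply: leq_trans (leq_mul le_m1 le_find) _.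
    by rewrite [N ^ 5]expnS; lia.
  have le4 : n * (n * (60 * p + 30 * n + 300) + 300) <= 690 * N ^ 3.
    apply: (@leq_trans (N * (N * (390 * N) + 300 * (N * N)))).
      apply: leq_mul => //; apply: leq_add; first by apply: leq_mul => //; lia.
      by have := leq_mul N_gt0 N_gt0; lia.
    by rewrite [N ^ 3]expnS expnS expn1; lia.
  have := powN 2 5 isT; have := powN 3 5 isT; have := powN 0 5 isT.
  by rewrite expn0; lia.
set Z := n ^ (2 * z); have Z_gt0 : 0 < Z by rewrite expn_gt0 n_gt0.
have le_Z : n ^ (2 * z.+1) <= N ^ 2 * Z.
  by rewrite mulnS expnD leq_mul2r leq_exp2r // le_n orbT.
have le_main : step_time m n p l * x.+1 * n ^ (2 * z.+1) <=
    172 * 100 * (N ^ 9 * Z).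
  have le_x1 : x.+1 <= 2 * N ^ 2 by apply: leq_trans le_np.
  apply: leq_trans (leq_mul (leq_mul le_step le_x1) le_Z) _.
  have -> : N ^ 9 = N ^ 5 * N ^ 2 * N ^ 2 by rewrite -!expnD.
  by move: (N ^ 5) (N ^ 2) => N5 N2; clear; lia.
have le_best : m.+1 * (200 * (n.+1 * p.+1) + 100) <= 1800 * N ^ 3.
  apply: (@leq_trans (2 * N * (900 * N ^ 2))).
    apply: leq_mul => //; have := powN 0 2 isT; rewrite expn0; lia.
  by rewrite [N ^ 3]expnS; lia.
have le_NZ : N ^ 9 <= N ^ 9 * Z by rewrite leq_pmulr.
rewrite -[leqRHS]mulnA.
have := powN 3 9 isT; have := powN 0 9 isT; rewrite expn0.
move: (N ^ 9 * Z) (N ^ 9) (N ^ 3) le_NZ le_main le_best => NZ N9 N3.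
by clear; lia.
Qed.

Lemma size_tree_seq (T : Type) (enc : T -> tree) s :
  size s < tree_size (enc_seq enc s).
Proof. by elim: s => // x s IH; rewrite enc_cons /= ltnS ltn_addl. Qed.

Lemma mem_tree_seq (T : eqType) (enc : T -> tree) s x :
  x \in s -> tree_size (enc x) <= tree_size (enc_seq enc s).
Proof.
elim: s => // y s IH; rewrite inE enc_cons /= => /orP[/eqP->|/IH le_s].
  by rewrite leqW // leq_addr.
by rewrite leqW // (leq_trans le_s) // leq_addl.
Qed.

(** Positive [m] and [n] provide a vector [V i0 j0], through which [p] is visible in the
    encoding. *)
Lemma dims_le_size m n p (V : vectors m n p) k : 0 < m -> 0 < n ->
  [/\ m <= instance_size V k, n <= instance_size V k, p <= instance_size V k &
      size (nat_bits k) <= instance_size V k].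
Proof.
move=> m_gt0 n_gt0; set i0 := Ordinal m_gt0; set j0 := Ordinal n_gt0.
rewrite /instance_size /enc_instance -[map _ (enum 'I_m)]/(all_rows V) /=.
have le_k := size_tree_seq enc_bool (nat_bits k).
have le_m := size_tree_seq mat (all_rows V).
rewrite size_map size_enum_ord in le_m.
have le_rows : tree_size (mat (rows V i0)) <= tree_size (sys (all_rows V)).
  by apply: mem_tree_seq; rewrite map_f ?mem_enum.
have le_n := size_tree_seq vec (rows V i0).
rewrite size_map size_enum_ord in le_n.
have le_vec : tree_size (vec (V i0 j0)) <= tree_size (mat (rows V i0)).
  by apply: mem_tree_seq; apply/mapP; exists j0; rewrite ?mem_enum.
have le_p := size_tree_seq enc_bool (V i0 j0).
rewrite size_tuple in le_p.
rewrite /enc_nat; split; arith.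
Qed.

Import Order.TTheory GRing.Theory Num.Theory.

(** Both sides have logarithm [2 * z * ln n]. *)
Lemma powR4_log2 (R : realType) (z n : nat) : 0 < n ->
  (4 `^ (z%:R * log2 (n%:R : R)))%R = ((n ^ (2 * z))%N%:R)%R.
Proof.
move=> n_gt0.
have ln2 : (ln (2 : R) != 0)%R by rewrite gt_eqF // ln_gt0 // ltr1n.
have -> : (4 : R)%R = (2 ^+ 2)%R by rewrite -natrX.
rewrite /powR expf_eq0 /= pnatr_eq0 /= lnXn ?ltr0n //.
have n_pos : (0 < n%:R :> R)%R by rewrite ltr0n.
rewrite -[RHS]lnK ?posrE ?ltr0n ?expn_gt0 ?n_gt0 // natrX lnXn //; congr (_ _).
rewrite /log2 -[(ln n%:R *+ _)%R]mulr_natl natrM -[(ln 2 *+ 2)%R]mulr_natl.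
by field.
Qed.

Local Open Scope ring_scope.

Theorem theorem4 (R : realType) :
  exists (P : program) (a d : nat),
  forall (m n p k : nat) (V : vectors m n p),
    (0 < m)%N -> (0 < n)%N -> (0 < p)%N ->
    exists t : nat,
      runs_in P (enc_instance V k) (enc_bool (bMVA V k)) t /\
      (0 <= zeta V k ->
       t%:R <= a%:R * (instance_size V k)%:R ^+ d
               * (4 `^ ((zeta V k)%:~R * log2 (n%:R : R)))).
Proof.
exists prog, (200 * 100)%N, 9 => m n p k V m_gt0 n_gt0 _.
have [t le_t run_t] := run_main V k m_gt0 n_gt0.
exists t; split=> // zeta_ge0.
have le_Bk : (lower_bound V <= k)%N.
  by move: zeta_ge0; rewrite /zeta subr_ge0 lez_nat.
(* Since [lower_bound V <= k], the integer difference equals the truncated one, and the exponent in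
   [run_main] comes from [zeta + 1]. *)
rewrite /zeta subzn // -[_%:~R]/(_%:R) powR4_log2 // -natrX -!natrM ler_nat.
apply: leq_trans le_t _; rewrite subSn //.
have [le_m le_n le_p le_l] := dims_le_size V k m_gt0 n_gt0.
by apply: main_time_le; rewrite ?n_gt0 // leq_subr.
Qed.
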